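(* Let $(F,G,\triangleright,\triangleleft)$ be a matched pair of finite groups and let $a\in F$. Then $$\nu_n(\mathbb{C}G\#p_a)=\big|\{x\in G\mid(a,x)^n=(1,1)\text{ in }F\bowtie G\}\big|\qquad(\forall n\geq1),$$ where $\{p_b\}_{b\in F}$ is the basis of $\mathbb{C}^F$ dual to $F$, and $\mathbb{C}G\#p_a$ is the left module over the bismash product Hopf algebra $\mathbb{C}G\#\mathbb{C}^F$ with basis $\{y\#p_a\}_{y\in G}$ and action $(x\#p_b)\cdot(y\#p_a)=\delta_{b,\,y\triangleright a}\;xy\#p_a$ for $x,y\in G$, $b\in F$.
   Context: A matched pair of groups $(F,G,\triangleright,\triangleleft)$ consists of groups $F,G$ with a left action $\triangleright:G\times F\to F$ of $G$ on the set $F$ and a right action $\triangleleft:G\times F\to G$ of $F$ on the set $G$ such that $x\triangleright bc=(x\triangleright b)((x\triangleleft b)\triangleright c)$ and $xy\triangleleft b=(x\triangleleft(y\triangleright b))(y\triangleleft b)$ for $b,c\in F$, $x,y\in G$. The group $F\bowtie G$ is the set $F\times G$ with product $(a,x)(b,y)=(a(x\triangleright b),(x\triangleleft b)y)$. The bismash product $\mathbb{C}G\#\mathbb{C}^F$ is the semisimple Hopf algebra with basis $\{x\#p_b\mid x\in G,b\in F\}$, product $(x\#p_b)(y\#p_c)=\delta_{b,\,y\triangleright c}\,xy\#p_c$, unit $\sum_{b\in F}1\#p_b$, comultiplication $\Delta(x\#p_b)=\sum_{cd=b}(x\#p_c)\otimes((x\triangleleft c)\#p_d)$ and counit $\varepsilon(x\#p_b)=\delta_{b,1}$.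 For a finite-dimensional left module $V$ over a semisimple Hopf algebra $K$ over $\mathbb{C}$, the $n$-th Frobenius-Schur indicator is $\nu_n(V)=\langle\chi_V,\sum\Lambda_{(1)}\Lambda_{(2)}\cdots\Lambda_{(n)}\rangle$, where $\chi_V$ is the character of $V$ and $\Lambda$ is the integral of $K$ with $\varepsilon(\Lambda)=1$. *)

(* Defs.v *)
From HB Require Import structures.
From mathcomp Require Import all_boot all_order all_algebra all_fingroup all_field.
From mathcomp Require Import classical_sets reals complex.

Set Implicit Arguments.
Unset Strict Implicit.
Unset Printing Implicit Defensive.

Import GroupScope GRing.Theory.
Local Open Scope ring_scope.

Reserved Notation "u ⊗ v" (at level 40, left associativity).
Reserved Notation "x ▷ b" (at level 30, right associativity).
Reserved Notation "x ◁ b" (at level 30, right associativity).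

Section Tensor.
Variable k : fieldType.
Implicit Types U V W : vectType k.

(* U ⊗ V is modelled by its coordinates in the basis (u_i ⊗ v_j), where (u_i)
   and (v_j) are the canonical bases vbasis {:U} and vbasis {:V}. *)
Definition tens U V : Type := 'M[k]_(\dim {:U}, \dim {:V}).

HB.instance Definition _ U V :=
  Vector.copy (tens U V) 'M[k]_(\dim {:U}, \dim {:V}).

Definition tensor U V (u : U) (v : V) : tens U V :=
  \matrix_(i, j) (coord (vbasis {:U}) i u * coord (vbasis {:V}) j v).

(* The linear map U ⊗ V -> W induced by a bilinear map f : U -> V -> W. *)
Definition tens_lift U V W (f : U -> V -> W) (t : tens U V) : W :=
  \sum_i \sum_j (t : 'M_(_, _)) i j *:
     f (vbasis {:U})`_i (vbasis {:V})`_j.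

End Tensor.

Notation "u ⊗ v" := (tensor u v) : ring_scope.

Section TensorTheory.
Variable k : fieldType.
Implicit Types U V W : vectType k.

Fact tensor_linear_l U V (v : V) : linear (fun u : U => u ⊗ v).
Proof. by move=> a x y; apply/matrixP=> i j; rewrite !mxE linearP mulrDl mulrA. Qed.

Fact tensor_linear_r U V (u : U) : linear (fun v : V => u ⊗ v).
Proof. by move=> a x y; apply/matrixP=> i j; rewrite !mxE linearP mulrDr mulrCA. Qed.

Fact tens_lift_linear U V W (f : U -> V -> W) : linear (tens_lift f).
Proof.
move=> a x y; rewrite /tens_lift scaler_sumr -big_split; apply: eq_bigr => i _.
rewrite scaler_sumr -big_split; apply: eq_bigr => j _ /=.
by rewrite !mxE scalerDl scalerA.
Qed.

HB.instance Definition _ U V (u : U) :=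
  GRing.isLinear.Build k V (tens U V) _ (tensor u) (tensor_linear_r u).
HB.instance Definition _ U V W (f : U -> V -> W) :=
  GRing.isLinear.Build k (tens U V) W _ (tens_lift f) (tens_lift_linear f).

Lemma tens_liftE U V W (f : U -> V -> W) :
    (forall v, linear (f^~ v)) -> (forall u, linear (f u)) ->
  forall u v, tens_lift f (u ⊗ v) = f u v.
Proof.
move=> lf rf u v.
pose fl v := HB.pack_for {linear U -> W} (f^~ v) (GRing.isLinear.Build _ _ _ _ _ (lf v)).
pose fr u := HB.pack_for {linear V -> W} (f u) (GRing.isLinear.Build _ _ _ _ _ (rf u)).
rewrite [in RHS](coord_vbasis (memvf u)).
rewrite -[RHS]/(fl v _) linear_sum; apply: eq_bigr => i _; rewrite linearZ /=.
rewrite [in RHS](coord_vbasis (memvf v)).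
rewrite -[f _ _]/(fr _ _) linear_sum scaler_sumr; apply: eq_bigr => j _.
by rewrite linearZ /= mxE scalerA.
Qed.

Definition tens_map U V U' V' (f : U -> U') (g : V -> V') :
  tens U V -> tens U' V' := tens_lift (fun u v => f u ⊗ g v).

Definition tens_assoc U V W : tens (tens U V) W -> tens U (tens V W) :=
  tens_lift (fun t w => tens_lift (fun u v => u ⊗ (v ⊗ w)) t).

Definition tens_mul (A B : falgType k) (s t : tens A B) : tens A B :=
  tens_lift (fun a b => tens_lift (fun a' b' => (a * a') ⊗ (b * b')) t) s.

Lemma tens_mapE U V U' V' (f : {linear U -> U'}) (g : {linear V -> V'}) u v :
  tens_map f g (u ⊗ v) = f u ⊗ g v.
Proof.
apply: (tens_liftE (f := fun u v => f u ⊗ g v)) => [{}v a x y|{}u a x y] /=.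
  by rewrite linearP tensor_linear_l.
by rewrite !linearP.
Qed.

Lemma tensor0l U V (v : V) : (0 : U) ⊗ v = 0.
Proof. by apply/matrixP=> i j; rewrite !mxE linear0 mul0r. Qed.

Fact tens_lift_linear_fun U V W (X : vectType k) (f : W -> U -> V -> X) :
  (forall u v, linear (fun w => f w u v)) ->
  forall t, linear (fun w => tens_lift (f w) t).
Proof.
move=> lf t a x y; rewrite /tens_lift scaler_sumr -big_split; apply: eq_bigr => i _.
rewrite scaler_sumr -big_split; apply: eq_bigr => j _ /=.
by rewrite lf scalerDr !scalerA mulrC.
Qed.

Lemma tens_assocE U V W (t : tens U V) (w : W) :
  tens_assoc (t ⊗ w) = tens_lift (fun u v => u ⊗ (v ⊗ w)) t.
Proof.
apply: (tens_liftE
  (f := fun t w => tens_lift (fun (u : U) (v : V) => u ⊗ (v ⊗ w)) t)).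
  by move=> {}w; apply: tens_lift_linear.
move=> {}t; apply: (tens_lift_linear_fun (f := fun w u v => u ⊗ (v ⊗ w))).
by move=> u v a x y; rewrite !linearP.
Qed.

Lemma tens_mul_tensor (A B : falgType k) (a a' : A) (b b' : B) :
  tens_mul (a ⊗ b) (a' ⊗ b') = (a * a') ⊗ (b * b').
Proof.
rewrite /tens_mul (tens_liftE (f := fun a b =>
    tens_lift (fun a' b' => (a * a') ⊗ (b * b')) (a' ⊗ b'))); first 1 last.
- move=> y; apply: (tens_lift_linear_fun (f := fun a a' b' => (a * a') ⊗ (y * b'))).
  by move=> u v c x z; rewrite mulrDl -scalerAl tensor_linear_l.
- move=> y; apply: (tens_lift_linear_fun (f := fun b a' b' => (y * a') ⊗ (b * b'))).
  by move=> u v c x z; rewrite mulrDl -scalerAl linearP.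
apply: (tens_liftE (f := fun a' b' => (a * a') ⊗ (b * b'))) => [v|u] c x y.
  by rewrite mulrDr -scalerAr tensor_linear_l.
by rewrite mulrDr -scalerAr linearP.
Qed.

Fact tens_mul_linear_r (A B : falgType k) (s : tens A B) : linear (tens_mul s).
Proof.
apply: (tens_lift_linear_fun
  (f := fun t a b => tens_lift (fun a' b' => (a * a') ⊗ (b * b')) t)) => a b.
exact: tens_lift_linear.
Qed.

Fact tens_mul_linear_l (A B : falgType k) (t : tens A B) : linear (fun s : tens A B => tens_mul s t).
Proof. exact: tens_lift_linear. Qed.

Fact tens_map_linear U V U' V' (f : U -> U') (g : V -> V') : linear (tens_map f g).
Proof. exact: tens_lift_linear. Qed.
HB.instance Definition _ U V U' V' (f : U -> U') (g : V -> V') :=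
  GRing.isLinear.Build k (tens U V) (tens U' V') _ (tens_map f g)
    (tens_map_linear f g).

Fact tens_assoc_linear U V W : linear (@tens_assoc U V W).
Proof. exact: tens_lift_linear. Qed.
HB.instance Definition _ U V W :=
  GRing.isLinear.Build k (tens (tens U V) W) (tens U (tens V W)) _
    (@tens_assoc U V W) (@tens_assoc_linear U V W).

End TensorTheory.

HB.mixin Record Falgebra_isHopf (k : fieldType) (A : Type) of Falgebra k A := {
  comul : A -> tens A A;
  counit : A -> k;
  antipode : A -> A;
  comul_linear : linear comul;
  counit_linear : scalar counit;
  antipode_linear : linear antipode;
  comulA : forall a,
    tens_assoc (tens_map comul id (comul a)) = tens_map id comul (comul a);
  counitl : forall a, tens_lift (fun x y => counit x *: y) (comul a) = a;
  counitr : forall a, tens_lift (fun x y => counit y *: x) (comul a) = a;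
  comul1 : comul 1 = 1 ⊗ 1;
  comulM : forall a b, comul (a * b) = tens_mul (comul a) (comul b);
  counit1 : counit 1 = 1;
  counitM : forall a b, counit (a * b) = counit a * counit b;
  antipodel : forall a,
    tens_lift (fun x y => antipode x * y) (comul a) = counit a *: 1;
  antipoder : forall a,
    tens_lift (fun x y => x * antipode y) (comul a) = counit a *: 1
}.

#[short(type="hopfType")]
HB.structure Definition Hopf (k : fieldType) :=
  {A of Falgebra_isHopf k A & Falgebra k A}.

HB.instance Definition _ (k : fieldType) (A : hopfType k) :=
  GRing.isLinear.Build k A (tens A A) _ comul comul_linear.
HB.instance Definition _ (k : fieldType) (A : hopfType k) :=
  GRing.isLinear.Build k A k _ counit counit_linear.
HB.instance Definition _ (k : fieldType) (A : hopfType k) :=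
  GRing.isLinear.Build k A A _ antipode antipode_linear.

Record alg_module (k : fieldType) (A : falgType k) := AlgModule {
  mod_space :> vectType k;
  mod_act : A -> 'End(mod_space);
  mod_act_linear : linear mod_act;
  mod_act1 : mod_act 1 = \1%VF;
  mod_actM : forall a b, mod_act (a * b) = (mod_act a \o mod_act b)%VF
}.

Definition mod_char (k : fieldType) (A : falgType k) (V : alg_module A) (a : A) : k :=
  \tr (passmx.mxof (vbasis {:V}) (vbasis {:V}) (mod_act V a)).

Section Indicator.
Variables (k : fieldType) (K : hopfType k).

Definition is_integral (L : K) : Prop :=
  forall h : K, h * L = counit h *: L /\ L * h = counit h *: L.

(* The integral with counit 1, which exists (and is then unique) iff K is
   semisimple; the default value 0 is only taken when K is not semisimple. *)
Definition normalized_integral : K :=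
  xget 0 (fun L : K => is_integral L /\ counit L = 1).

(* h_(1) h_(2) ... h_(n), i.e. the n-th convolution power of the identity. *)
Fixpoint sweedler_power (n : nat) (h : K) : K :=
  if n is m.+1
  then tens_lift (fun h1 h2 => h1 * sweedler_power m h2) (comul h)
  else counit h *: 1.

Definition FS_indicator (n : nat) (V : alg_module K) : k :=
  mod_char V (sweedler_power n normalized_integral).

End Indicator.

Record matched_pair (F G : groupType) := MatchedPair {
  mp_lact : G -> F -> F;
  mp_ract : G -> F -> G;
  mp_lact1 : forall b, mp_lact 1%g b = b;
  mp_lactM : forall x y b, mp_lact (x * y)%g b = mp_lact x (mp_lact y b);
  mp_ract1 : forall x, mp_ract x 1%g = x;
  mp_ractM : forall x b c, mp_ract x (b * c)%g = mp_ract (mp_ract x b) c;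
  mp_lact_mul : forall x b c, mp_lact x (b * c)%g = (mp_lact x b * mp_lact (mp_ract x b) c)%g;
  mp_ract_mul : forall x y b, mp_ract (x * y)%g b = (mp_ract x (mp_lact y b) * mp_ract y b)%g
}.

Section MatchedPairTheory.
Variables (F G : groupType) (M : matched_pair F G).
Local Notation "x ▷ b" := (mp_lact M x b).
Local Notation "x ◁ b" := (mp_ract M x b).

Lemma mp_lactV x b c : (x ▷ b = c) <-> (b = x^-1%g ▷ c).
Proof. by split=> [<-|->]; rewrite -mp_lactM ?mulgV ?mulVg mp_lact1. Qed.

Lemma mp_lact_1 x : x ▷ 1%g = 1%g.
Proof.
have := mp_lact_mul M x 1%g 1%g; rewrite mulg1 mp_ract1 => /(congr1 (mulg (x ▷ 1%g)^-1)).
by rewrite mulKg mulVg.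
Qed.

Lemma mp_ract_1 b : 1%g ◁ b = 1%g.
Proof.
have := mp_ract_mul M 1%g 1%g b; rewrite mulg1 mp_lact1 => /(congr1 (mulg (1%g ◁ b)^-1)).
by rewrite mulKg mulVg.
Qed.

Lemma mp_lact_inv x b : (x ▷ b)^-1%g = (x ◁ b) ▷ b^-1%g.
Proof.
apply: (mulgI (x ▷ b)); rewrite mulgV -mp_lact_mul.
by rewrite mulgV mp_lact_1.
Qed.

Lemma mp_ract_inv x b : (x ◁ b)^-1%g = x^-1%g ◁ (x ▷ b).
Proof.
apply: (mulIg (x ◁ b)); rewrite mulVg -mp_ract_mul.
by rewrite mulVg mp_ract_1.
Qed.

End MatchedPairTheory.

Section Bowtie.
Variables (F G : groupType) (M : matched_pair F G).
Local Notation "x ▷ b" := (mp_lact M x b).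
Local Notation "x ◁ b" := (mp_ract M x b).

Definition bowtie of matched_pair F G : Type := (F * G)%type.
Local Notation B := (bowtie M).
HB.instance Definition _ := Choice.copy B (F * G)%type.

Definition bowtie_one : B := (1%g, 1%g).
Definition bowtie_mul (u v : B) : B :=
  ((u.1 * (u.2 ▷ v.1))%g, ((u.2 ◁ v.1) * v.2)%g).
Definition bowtie_inv (u : B) : B :=
  (u.2^-1%g ▷ u.1^-1%g, u.2^-1%g ◁ u.1^-1%g).

Fact bowtie_mulA : associative bowtie_mul.
Proof.
move=> [a x] [b y] [c z]; rewrite /bowtie_mul /=; congr pair.
  by rewrite mp_lact_mul mp_lactM mulgA.
by rewrite mp_ractM mp_ract_mul mulgA.
Qed.
Fact bowtie_mul1 : left_id bowtie_one bowtie_mul.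
Proof. by case=> a x; rewrite /bowtie_mul /= mp_lact1 mp_ract_1 !mul1g. Qed.
Fact bowtie_mulr1 : right_id bowtie_one bowtie_mul.
Proof. by case=> a x; rewrite /bowtie_mul /= mp_lact_1 mp_ract1 !mulg1. Qed.
Fact bowtie_mulV : left_inverse bowtie_one bowtie_inv bowtie_mul.
Proof.
case=> a x; rewrite /bowtie_mul /bowtie_inv /=; congr pair.
  by rewrite -mp_lact_mul mulVg mp_lact_1.
rewrite -mp_ractM mulVg mp_ract1; exact: mulVg.
Qed.
Fact bowtie_mulrV : right_inverse bowtie_one bowtie_inv bowtie_mul.
Proof.
case=> a x; rewrite /bowtie_mul /bowtie_inv /=; congr pair.
  by rewrite -mp_lactM mulgV mp_lact1 mulgV.
by rewrite -mp_ract_mul mulgV mp_ract_1.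
Qed.

HB.instance Definition _ := isGroup.Build B
  bowtie_mulA bowtie_mul1 bowtie_mulr1 bowtie_mulV bowtie_mulrV.

End Bowtie.

Section FreeSpace.
Variables (k : fieldType) (I : finType).

(* The k-vector space with basis I. *)
Definition free_space : Type := {ffun I -> k^o}.
HB.instance Definition _ := Vector.copy free_space {ffun I -> k^o}.

Definition basis_vec (i : I) : free_space := [ffun j => (j == i)%:R].

Definition lin_ext (W : lmodType k) (f : I -> W) (h : free_space) : W :=
  \sum_i (h : {ffun I -> k^o}) i *: f i.

Fact lin_ext_linear (W : lmodType k) (f : I -> W) : linear (lin_ext f).
Proof.
move=> a x y; rewrite /lin_ext scaler_sumr -big_split; apply: eq_bigr => i _ /=.
by rewrite !ffunE scalerDl scalerA.
Qed.
HB.instance Definition _ (W : lmodType k) (f : I -> W) :=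
  GRing.isLinear.Build k free_space W _ (lin_ext f) (lin_ext_linear f).

Lemma lin_extE (W : lmodType k) (f : I -> W) i : lin_ext f (basis_vec i) = f i.
Proof.
rewrite /lin_ext (bigD1 i) //= ffunE eqxx scale1r big1 ?addr0 // => j /negPf ji.
by rewrite ffunE ji scale0r.
Qed.

Lemma lin_ext_id (h : free_space) : h = lin_ext basis_vec h.
Proof.
apply/ffunP=> j; rewrite /lin_ext sum_ffunE (bigD1 j) //= !ffunE eqxx.
rewrite big1 ?addr0 => [|i /negPf ij]; first by rewrite /GRing.scale /= mulr1.
by rewrite !ffunE eq_sym ij scaler0.
Qed.

Lemma free_ext (W : lmodType k) (f g : free_space -> W) :
    linear f -> linear g ->
  (forall i, f (basis_vec i) = g (basis_vec i)) -> f =1 g.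
Proof.
move=> lf lg fg h.
pose f' := HB.pack_for {linear free_space -> W} f (GRing.isLinear.Build _ _ _ _ _ lf).
pose g' := HB.pack_for {linear free_space -> W} g (GRing.isLinear.Build _ _ _ _ _ lg).
rewrite -[LHS]/(f' h) -[RHS]/(g' h) (lin_ext_id h) !linear_sum.
by apply: eq_bigr => i _; rewrite !linearZ /= fg.
Qed.

End FreeSpace.

Section Bismash.
Variables (k : fieldType) (F G : finGroupType) (M : matched_pair F G).
Local Notation "x ▷ b" := (mp_lact M x b).
Local Notation "x ◁ b" := (mp_ract M x b).

Definition bismash (k : fieldType) (F G : finGroupType) of matched_pair F G : Type :=
  free_space k (G * F)%type.
Local Notation H := (bismash k M).
HB.instance Definition _ := Vector.copy H (free_space k (G * F)%type).

(* The basis element x # p_b. *)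
Definition bsm (x : G) (b : F) : H := basis_vec k (x, b).

Definition bsm_one : H := \sum_b bsm 1%g b.

Definition bsm_mul (u v : H) : H :=
  lin_ext (fun xb => lin_ext (fun yc =>
    if xb.2 == yc.1 ▷ yc.2 then bsm (xb.1 * yc.1)%g yc.2 else 0) v) u.

Definition bsm_comul : H -> tens H H :=
  lin_ext (fun xb =>
    \sum_c \sum_(d | (c * d == xb.2)%g) bsm xb.1 c ⊗ bsm (xb.1 ◁ c) d).

Definition bsm_counit : H -> k :=
  lin_ext (fun xb => if xb.2 == 1%g then 1 else 0 : k^o).

Definition bsm_antipode : H -> H :=
  lin_ext (fun xb => bsm (xb.1 ◁ xb.2)^-1%g (xb.1 ▷ xb.2)^-1%g).

Lemma bsm_ext (W : lmodType k) (f g : H -> W) : linear f -> linear g ->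
  (forall x b, f (bsm x b) = g (bsm x b)) -> f =1 g.
Proof. by move=> lf lg fg; apply: free_ext => // -[x b]; apply: fg. Qed.

Fact bsm_mul_linear_r u : linear (bsm_mul u).
Proof.
have E v : bsm_mul u v = \sum_xb (u : {ffun _ -> k^o}) xb *: lin_ext (fun yc =>
    if xb.2 == yc.1 ▷ yc.2 then bsm (xb.1 * yc.1)%g yc.2 else 0) v by [].
move=> a v w; rewrite !E scaler_sumr -big_split.
by apply: eq_bigr => i _ /=; rewrite linearP scalerDr !scalerA mulrC.
Qed.
Fact bsm_mul_linear_l v : linear (bsm_mul^~ v).
Proof. by move=> a u w; rewrite /bsm_mul linearP. Qed.

Fact bsm_mul_basis x b y c : bsm_mul (bsm x b) (bsm y c) =
  if b == y ▷ c then bsm (x * y)%g c else 0.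
Proof. by rewrite /bsm_mul /bsm !lin_extE. Qed.

HB.instance Definition _ u := GRing.isLinear.Build k H H _ (bsm_mul u) (bsm_mul_linear_r u).

Fact bsm_mulDl : left_distributive bsm_mul +%R.
Proof. by move=> u v w; have := bsm_mul_linear_l w 1 u v; rewrite !scale1r. Qed.
Fact bsm_mulDr : right_distributive bsm_mul +%R.
Proof. by move=> u v w; rewrite linearD. Qed.
Fact bsm_mulZl a u v : bsm_mul (a *: u) v = a *: bsm_mul u v.
Proof. by rewrite /bsm_mul linearZ. Qed.
Lemma bsm_mul0l v : bsm_mul 0 v = 0.
Proof. by rewrite /bsm_mul linear0. Qed.

Fact bsm_mulA : associative bsm_mul.
Proof.
move=> u v w; move: u; apply: bsm_ext => [a u u'|a u u'|x b].
- exact: bsm_mul_linear_l.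
- by rewrite !bsm_mul_linear_l.
move: v; apply: bsm_ext => [a v v'|a v v'|y c].
- by rewrite bsm_mul_linear_l linearP.
- by rewrite linearP bsm_mul_linear_l.
move: w; apply: bsm_ext => [a v v'|a v v'|z d].
- by rewrite !linearP.
- by rewrite linearP.
rewrite !bsm_mul_basis; case: ifP => [/eqP->|cd]; last first.
  case: ifP; rewrite ?linear0 ?bsm_mul0l // => _.
  by rewrite bsm_mul_basis cd.
rewrite bsm_mul_basis mp_lactM; case: ifP; rewrite ?linear0 ?bsm_mul0l // => _.
by rewrite bsm_mul_basis eqxx mulgA.
Qed.

Fact bsm_mul1l : left_id bsm_one bsm_mul.
Proof.
apply: bsm_ext => [a u v|a u v //|x b]; first by rewrite linearP.
rewrite /bsm_one [LHS](@raddf_sum _ _ (lin_ext _)) /= (bigD1 (x ▷ b)) //=.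
rewrite [X in X + _]bsm_mul_basis eqxx mul1g big1 ?addr0 // => c /negPf cb.
by rewrite [LHS]bsm_mul_basis cb.
Qed.

Fact bsm_mulr1 : right_id bsm_one bsm_mul.
Proof.
apply: bsm_ext => [a u v|a u v //|x b]; first by rewrite bsm_mul_linear_l.
rewrite /bsm_one linear_sum (bigD1 b) //= bsm_mul_basis mp_lact1 eqxx mulg1.
rewrite big1 ?addr0 // => c /negPf cb.
by rewrite bsm_mul_basis mp_lact1 eq_sym cb.
Qed.

Fact bsm_counit_linear : scalar bsm_counit.
Proof. by move=> a u v; rewrite /bsm_counit linearP. Qed.

Lemma bsm_counitE x b : bsm_counit (bsm x b) = (b == 1%g)%:R.
Proof. by rewrite /bsm_counit /bsm lin_extE; case: eqP. Qed.

HB.instance Definition _ := GRing.isLinear.Build k H k _ bsm_counit bsm_counit_linear.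

Lemma bsm_counit1 : bsm_counit bsm_one = 1.
Proof.
rewrite /bsm_one linear_sum (bigD1 1%g) //= bsm_counitE eqxx.
by rewrite big1 ?addr0 // => b /negPf b1; rewrite bsm_counitE b1.
Qed.

Fact bsm_one_neq0 : bsm_one != 0.
Proof.
by apply/eqP => h; have := bsm_counit1; rewrite h linear0 => /esym/eqP; rewrite oner_eq0.
Qed.

HB.instance Definition _ := GRing.Zmodule_isNzRing.Build H
  bsm_mulA bsm_mul1l bsm_mulr1 bsm_mulDl bsm_mulDr bsm_one_neq0.

Fact bsm_scaleAl (a : k) (u v : H) : a *: (u * v) = (a *: u) * v.
Proof. exact: esym (bsm_mulZl a u v). Qed.
HB.instance Definition _ := GRing.Lmodule_isLalgebra.Build k H bsm_scaleAl.
Fact bsm_scaleAr (a : k) (u v : H) : a *: (u * v) = u * (a *: v).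
Proof. exact: esym (linearZ_LR (bsm_mul u) a v). Qed.
HB.instance Definition _ := GRing.Lalgebra_isAlgebra.Build k H bsm_scaleAr.
HB.instance Definition _ := Algebra_isFalgebra.Build k H.

Lemma bsm_mulE x b y c :
  bsm x b * bsm y c = if b == y ▷ c then bsm (x * y)%g c else 0.
Proof. exact: bsm_mul_basis. Qed.

Lemma bsm_oneE : 1 = \sum_b bsm 1%g b.
Proof. by []. Qed.

Fact bsm_comul_linear : linear bsm_comul.
Proof. exact: lin_ext_linear. Qed.
HB.instance Definition _ :=
  GRing.isLinear.Build k H (tens H H) _ bsm_comul bsm_comul_linear.

Lemma bsm_comulE x b :
  bsm_comul (bsm x b) = \sum_c bsm x c ⊗ bsm (x ◁ c) (c^-1 * b)%g.
Proof.
rewrite /bsm_comul /bsm lin_extE; apply: eq_bigr => c _ /=.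
by rewrite (big_pred1 (c^-1 * b)%g) // => d /=; rewrite eq_sym eq_mulVg1 mulgA -eq_invg_mul invMg invgK.
Qed.

Lemma bsm_lift_comul (W : vectType k) (f : H -> H -> W) :
    (forall v, linear (f^~ v)) -> (forall u, linear (f u)) -> forall x b,
  tens_lift f (bsm_comul (bsm x b)) =
  \sum_c f (bsm x c) (bsm (x ◁ c) (c^-1 * b)%g).
Proof.
move=> lf rf x b; rewrite bsm_comulE linear_sum /=.
by apply: eq_bigr => c _; rewrite tens_liftE.
Qed.

Fact bsm_antipode_linear : linear bsm_antipode.
Proof. exact: lin_ext_linear. Qed.
HB.instance Definition _ :=
  GRing.isLinear.Build k H H _ bsm_antipode bsm_antipode_linear.

Lemma bsm_antipodeE x b :
  bsm_antipode (bsm x b) = bsm (x ◁ b)^-1%g (x ▷ b)^-1%g.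
Proof. by rewrite /bsm_antipode /bsm lin_extE. Qed.

Fact bsm_comulA a :
  tens_assoc (tens_map bsm_comul id (bsm_comul a)) =
  tens_map id bsm_comul (bsm_comul a).
Proof.
move: a; apply: bsm_ext => [a u v|a u v|x b].
- by rewrite /tens_assoc /tens_map !linearP.
- by rewrite /tens_map !linearP.
rewrite /tens_map bsm_lift_comul => [|v a u u'|u a v v']; last 2 first.
- by rewrite linearP tensor_linear_l.
- by rewrite linearP.
rewrite bsm_lift_comul => [|v a u u'|u a v v']; last 2 first.
- by rewrite tensor_linear_l.
- by rewrite !linearP.
have l1 (w : H) (v : H) : linear (fun u : H => u ⊗ (v ⊗ w)).
  by move=> a u u'; rewrite tensor_linear_l.
have l2 (w : H) (u : H) : linear (fun v : H => u ⊗ (v ⊗ w)).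
  by move=> a v v'; rewrite tensor_linear_l linearP.
have E c (w : H) : tens_assoc (bsm_comul (bsm x c) ⊗ w) =
    \sum_d bsm x d ⊗ (bsm (x ◁ d) (d^-1 * c)%g ⊗ w).
  by rewrite tens_assocE (bsm_lift_comul (f := fun u v => u ⊗ (v ⊗ w))).
rewrite [LHS]linear_sum /=.
rewrite (eq_bigr _ (fun c _ => E c _)).
rewrite exchange_big; apply: eq_bigr => c _ /=.
rewrite bsm_comulE linear_sum (reindex_inj (mulgI c)); apply: eq_bigr => d _ /=.
by rewrite mulKg mp_ractM invMg mulgA.
Qed.

Fact bsm_counitl a :
  tens_lift (fun u v : H => bsm_counit u *: v) (bsm_comul a) = a.
Proof.
move: a; apply: bsm_ext => [a u v|a u v //|x b]; first by rewrite !linearP.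
rewrite bsm_lift_comul => [|v a u u'|u a v v']; last 2 first.
- by rewrite linearP scalerDl scalerA.
- by rewrite scalerDr !scalerA mulrC.
rewrite (bigD1 1%g) //= bsm_counitE eqxx scale1r mp_ract1 invg1 mul1g.
by rewrite big1 ?addr0 // => c /negPf c1; rewrite bsm_counitE c1 scale0r.
Qed.

Fact bsm_counitr a :
  tens_lift (fun u v : H => bsm_counit v *: u) (bsm_comul a) = a.
Proof.
move: a; apply: bsm_ext => [a u v|a u v //|x b]; first by rewrite !linearP.
rewrite bsm_lift_comul => [|v a u u'|u a v v']; last 2 first.
- by rewrite scalerDr !scalerA mulrC.
- by rewrite linearP scalerDl scalerA.
rewrite (bigD1 b) //= bsm_counitE mulVg eqxx scale1r.
rewrite big1 ?addr0 // => c /negPf c1; rewrite bsm_counitE.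
by rewrite -eq_mulVg1 c1 scale0r.
Qed.

Fact bsm_comul1 : bsm_comul 1 = (1 : H) ⊗ (1 : H).
Proof.
rewrite bsm_oneE [LHS]linear_sum /=.
under eq_bigr => b _ do rewrite bsm_comulE.
rewrite exchange_big /=.
pose f v := HB.pack_for {linear H -> tens H H} (fun u : H => u ⊗ v)
  (GRing.isLinear.Build _ _ _ _ _ (tensor_linear_l v)).
rewrite -[RHS]/(f _ _) [RHS]linear_sum; apply: eq_bigr => c _ /=.
rewrite linear_sum (reindex_inj (mulgI c)); apply: eq_bigr => d _ /=.
by rewrite mp_ract_1 mulKg.
Qed.

Fact bsm_comulM (u v : H) : bsm_comul (u * v) = tens_mul (bsm_comul u) (bsm_comul v).
Proof.
move: u; apply: bsm_ext => [a u u'|a u u'|x b].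
- by rewrite mulrDl -scalerAl linearP.
- by rewrite linearP tens_mul_linear_l.
move: v; apply: bsm_ext => [a u u'|a u u'|y c].
- by rewrite mulrDr -scalerAr linearP.
- by rewrite linearP tens_mul_linear_r.
pose f v := HB.pack_for {linear tens H H -> tens H H} (tens_mul v)
  (GRing.isLinear.Build _ _ _ _ _ (tens_mul_linear_r v)).
pose g v := HB.pack_for {linear tens H H -> tens H H} (fun u : tens H H => tens_mul u v)
  (GRing.isLinear.Build _ _ _ _ _ (tens_mul_linear_l v)).
have E d : tens_mul (bsm_comul (bsm x b)) (bsm y d ⊗ bsm (y ◁ d) (d^-1 * c)%g) =
    if b == y ▷ c then bsm (x * y)%g d ⊗ bsm ((x * y)%g ◁ d) (d^-1 * c)%g else 0.
  rewrite bsm_comulE -[LHS]/(g _ _) [LHS]linear_sum (bigD1 (y ▷ d)) //=.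
  rewrite tens_mul_tensor !bsm_mulE eqxx big1 => [|e /negPf ed]; last first.
    by rewrite tens_mul_tensor bsm_mulE ed tensor0l.
  rewrite addr0 -mp_ract_mul.
  suff -> : ((y ▷ d)^-1 * b == (y ◁ d) ▷ (d^-1 * c))%g = (b == y ▷ c).
    by case: eqP; rewrite ?linear0.
  rewrite -(inj_eq (mulgI (y ▷ d))) mulKVg -mp_lact_mul mulKVg //.
rewrite (bsm_comulE y) -[RHS]/(f _ _) [RHS]linear_sum.
rewrite (eq_bigr _ (fun d _ => E d)) bsm_mulE; case: ifP => _.
  by rewrite bsm_comulE.
by rewrite linear0 big1.
Qed.

Fact bsm_counitM (u v : H) : bsm_counit (u * v) = bsm_counit u * bsm_counit v.
Proof.
move: u; apply: (bsm_ext (W := k^o)) => [a u u'|a u u'|x b].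
- by rewrite mulrDl -scalerAl linearP.
- by rewrite linearP mulrDl -mulrA.
move: v; apply: (bsm_ext (W := k^o)) => [a u u'|a u u'|y c].
- by rewrite mulrDr -scalerAr linearP.
- by rewrite linearP mulrDr mulrCA.
rewrite bsm_mulE !bsm_counitE; case: ifP => [/eqP->|bc].
  rewrite bsm_counitE; case: (c =P 1%g) => [->|c1]; last by rewrite mulr0.
  by rewrite mp_lact_1 eqxx mulr1.
rewrite linear0; case: (c =P 1%g) bc => [->|c1 _]; last by rewrite mulr0.
by rewrite mp_lact_1 => ->; rewrite mul0r.
Qed.

Fact bsm_antipodel a :
  tens_lift (fun u v : H => bsm_antipode u * v) (bsm_comul a) = bsm_counit a *: 1.
Proof.
move: a; apply: bsm_ext => [a u v|a u v|x b]; first by rewrite !linearP.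
  by rewrite linearP scalerDl scalerA.
rewrite bsm_lift_comul => [|v a u u'|u a v v']; last 2 first.
- by rewrite linearP mulrDl -scalerAl.
- by rewrite mulrDr -scalerAr.
rewrite bsm_counitE.
have E c : bsm_antipode (bsm x c) * bsm (x ◁ c) (c^-1 * b)%g =
    (b == 1%g)%:R *: bsm 1%g (c^-1 * b)%g.
  rewrite bsm_antipodeE bsm_mulE mulVg.
  suff -> : ((x ▷ c)^-1%g == (x ◁ c) ▷ (c^-1 * b)%g) = (b == 1%g).
    by case: eqP; rewrite ?scale1r ?scale0r.
  rewrite eq_invg_mul -mp_lact_mul mulKVg; apply/eqP/eqP => [/mp_lactV->|->].
    by rewrite mp_lact_1.
  by rewrite mp_lact_1.
rewrite (eq_bigr _ (fun c _ => E c)) -scaler_sumr.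
case: eqP => [->|]; last by rewrite !scale0r.
rewrite !scale1r bsm_oneE (reindex_inj invg_inj); apply: eq_bigr => c _ /=.
by rewrite invgK mulg1.
Qed.

Fact bsm_antipoder a :
  tens_lift (fun u v : H => u * bsm_antipode v) (bsm_comul a) = bsm_counit a *: 1.
Proof.
move: a; apply: bsm_ext => [a u v|a u v|x b]; first by rewrite !linearP.
  by rewrite linearP scalerDl scalerA.
rewrite bsm_lift_comul => [|v a u u'|u a v v']; last 2 first.
- by rewrite mulrDl -scalerAl.
- by rewrite linearP mulrDr -scalerAr.
rewrite bsm_counitE.
have E c : bsm x c * bsm_antipode (bsm (x ◁ c) (c^-1 * b)%g) =
    (b == 1%g)%:R *: bsm 1%g (x ▷ c).
  rewrite bsm_antipodeE bsm_mulE -mp_ractM mulKVg.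
  rewrite mp_lact_inv -mp_ractM mulKVg -mp_lactM mulVg mp_lact1 invMg invgK.
  have -> : (c == (b^-1 * c)%g) = (b == 1%g).
    by rewrite -[X in X == _]mul1g (inj_eq (mulIg _)) eq_sym invg_eq1.
  case: eqP => [->|_]; last by rewrite scale0r.
  by rewrite scale1r mp_ract1 mulgV invg1 mul1g.
rewrite (eq_bigr _ (fun c _ => E c)) -scaler_sumr.
case: eqP => _; last by rewrite !scale0r.
rewrite !scale1r bsm_oneE [RHS](reindex (mp_lact M x)) //=.
exists (mp_lact M x^-1%g) => c _; first by rewrite -mp_lactM mulVg mp_lact1.
by rewrite -mp_lactM mulgV mp_lact1.
Qed.

HB.instance Definition _ := Falgebra_isHopf.Build k H
  bsm_comul_linear bsm_counit_linear bsm_antipode_linear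
  bsm_comulA bsm_counitl bsm_counitr bsm_comul1 bsm_comulM
  bsm_counit1 bsm_counitM bsm_antipodel bsm_antipoder.

(* The space of CG # p_a, with basis (y # p_a)_y indexed by y : G. *)
Definition bsm_fiber : Type := free_space k G.
HB.instance Definition _ := Vector.copy bsm_fiber (free_space k G).

Variable a : F.

Definition bsm_fiber_act (h : H) (v : bsm_fiber) : bsm_fiber :=
  lin_ext (fun xb => lin_ext (fun y =>
    if xb.2 == y ▷ a then basis_vec k (xb.1 * y)%g else 0) v) h.

Fact bsm_fiber_act_linear h : linear (bsm_fiber_act h).
Proof.
have E v : bsm_fiber_act h v = \sum_xb (h : {ffun _ -> k^o}) xb *: lin_ext (fun y =>
    if xb.2 == y ▷ a then basis_vec k (xb.1 * y)%g else 0) v by [].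
move=> c v w; rewrite !E scaler_sumr -big_split.
by apply: eq_bigr => i _ /=; rewrite linearP scalerDr !scalerA mulrC.
Qed.
HB.instance Definition _ h :=
  GRing.isLinear.Build k bsm_fiber bsm_fiber _ (bsm_fiber_act h) (bsm_fiber_act_linear h).

Lemma bsm_fiber_actE x b y : bsm_fiber_act (bsm x b) (basis_vec k y) =
  if b == y ▷ a then basis_vec k (x * y)%g else 0.
Proof. by rewrite /bsm_fiber_act /bsm !lin_extE. Qed.

Fact bsm_fiber_act_linear_l v : linear (bsm_fiber_act^~ v).
Proof. by move=> c u w; rewrite /bsm_fiber_act linearP. Qed.

Lemma bsm_fiber_ext (W : lmodType k) (f g : bsm_fiber -> W) : linear f -> linear g ->
  (forall y, f (basis_vec k y) = g (basis_vec k y)) -> f =1 g.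
Proof. exact: free_ext. Qed.

Fact bsm_fiber_act1 v : bsm_fiber_act 1 v = v.
Proof.
move: v; apply: bsm_fiber_ext => [c v w|c v w //|y]; first by rewrite linearP.
pose f v := HB.pack_for {linear H -> bsm_fiber} (bsm_fiber_act^~ v)
  (GRing.isLinear.Build _ _ _ _ _ (bsm_fiber_act_linear_l v)).
rewrite bsm_oneE -[LHS]/(f _ _) linear_sum (bigD1 (y ▷ a)) //= bsm_fiber_actE eqxx.
rewrite mul1g big1 ?addr0 // => c /negPf cy.
by rewrite bsm_fiber_actE cy.
Qed.

Fact bsm_fiber_actM (u v : H) w :
  bsm_fiber_act (u * v) w = bsm_fiber_act u (bsm_fiber_act v w).
Proof.
move: u; apply: bsm_ext => [c u u'|c u u'|x b].
- by rewrite mulrDl -scalerAl bsm_fiber_act_linear_l.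
- by rewrite bsm_fiber_act_linear_l.
move: v; apply: bsm_ext => [c u u'|c u u'|y c].
- by rewrite mulrDr -scalerAr bsm_fiber_act_linear_l.
- by rewrite bsm_fiber_act_linear_l linearP.
move: w; apply: bsm_fiber_ext => [d v w|d v w|z]; rewrite ?linearP //.
rewrite bsm_mulE bsm_fiber_actE (fun_if (bsm_fiber_act^~ _)) bsm_fiber_actE.
have -> v : bsm_fiber_act 0 v = 0 by rewrite /bsm_fiber_act linear0.
case: (c =P z ▷ a) => [->|_]; last by rewrite linear0 if_same.
by rewrite bsm_fiber_actE mp_lactM mulgA.
Qed.

Definition bsm_module_act (h : H) : 'End(bsm_fiber) := linfun (bsm_fiber_act h).

Fact bsm_module_act_linear : linear bsm_module_act.
Proof.
move=> c u v; apply/lfunP => w; rewrite add_lfunE scale_lfunE !lfunE /=.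
exact: bsm_fiber_act_linear_l.
Qed.
Fact bsm_module_act1 : bsm_module_act 1 = \1%VF.
Proof. by apply/lfunP => w; rewrite !lfunE /= bsm_fiber_act1. Qed.
Fact bsm_module_actM (u v : H) :
  bsm_module_act (u * v) = (bsm_module_act u \o bsm_module_act v)%VF.
Proof. by apply/lfunP => w; rewrite comp_lfunE !lfunE /= bsm_fiber_actM. Qed.

Definition bsm_module : alg_module H :=
  AlgModule bsm_module_act_linear bsm_module_act1 bsm_module_actM.

End Bismash.

(* Main.v *)
(** The normalized integral is [|G|^-1 * sum_x x#p_1].  The [n]-th Sweedler
    power of [x#p_1] sends each [y#p_a] to a basis vector or to 0, and it fixes
    [y#p_a] exactly when [(a, z)^n = 1] in [F ⋈ G], where
    [z = (y ◁ a)^-1 x^-1 y].  For each fixed [y] the map [x |-> z] is a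
    bijection of [G], so the traces count every solution [z] exactly [|G|]
    times, which the factor [|G|^-1] cancels. *)

From HB Require Import structures.
Require Import Defs.
From mathcomp Require Import all_boot all_order all_algebra all_fingroup all_field.
From mathcomp Require Import classical_sets reals complex.

Import GRing.Theory.
Local Open Scope ring_scope.

(** The product of two normalized integrals equals each of them, so the choice made by [xget] is
    forced. *)
Lemma normalized_integralE (k : fieldType) (K : hopfType k) (L : K) :
  is_integral L -> counit L = 1 -> normalized_integral K = L.
Proof.
move=> intL cL; apply: xget_unique => // L' [intL' cL'].
have [_] := intL L'; have [] := intL' L.
by rewrite cL cL' !scale1r => -> _ ->.
Qed.

(** A case split suffices: in the successor case the argument enters only through [comul], and
    [tens_lift] is linear in its tensor. *)
Lemma sweedler_power_linear (k : fieldType) (K : hopfType k) (n : nat) :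
  linear (@sweedler_power k K n).
Proof.
case: n => [|n] c u v /=; first by rewrite linearP scalerDl scalerA.
by rewrite !linearP.
Qed.

Lemma mxtrace_free_space (k : fieldType) (I : finType)
    (f : 'End(free_space k I)) :
  \tr (passmx.mxof (vbasis {:free_space k I}) (vbasis {:free_space k I}) f) =
  \sum_i (f (basis_vec k i) : {ffun I -> k^o}) i.
Proof.
set e := vbasis _.
have fE v : f v = \sum_i (v : {ffun I -> k^o}) i *: f (basis_vec k i).
  rewrite {1}(lin_ext_id v) /lin_ext linear_sum.
  by apply: eq_bigr => i _; rewrite linearZ.
have E i : passmx.mxof e e f i i =
    \sum_j (e`_i : {ffun I -> k^o}) j * coord e i (f (basis_vec k j)).
  rewrite mxE /= mxE passmx.vecof_delta fE linear_sum.
  by apply: eq_bigr => j _; rewrite linearZ.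
rewrite /mxtrace (eq_bigr _ (fun i _ => E i)) exchange_big.
apply: eq_bigr => j _ /=.
rewrite [in RHS](coord_vbasis (memvf (f (basis_vec k j)))) sum_ffunE.
by apply: eq_bigr => i _; rewrite ffunE /GRing.scale /= mulrC.
Qed.

Section BismashIndicator.
Variables (k : fieldType) (F G : finGroupType) (M : matched_pair F G).
Local Notation "x ▷ b" := (mp_lact M x b).
Local Notation "x ◁ b" := (mp_ract M x b).
Local Notation B := (bowtie M).

Lemma bowtie_mulE (u v : B) :
  (u * v)%g = ((u.1 * (u.2 ▷ v.1))%g, ((u.2 ◁ v.1) * v.2)%g).
Proof. by []. Qed.

(* If x_1 = x, ..., x_n and c_1, ..., c_n are the components of the only term of
   the coproduct not killing y#p_a, then y_n = y, y_{i-1} = x_i y_i satisfy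
   (1, y_i) g = (c_i, y_{i+1}); this recursion dictates g. *)
Lemma bsm_sweedler_power_act (a : F) (n : nat) (x : G) (b : F) (y : G) :
  let w := x ◁ b in
  let g : B := (a, ((y ◁ a)^-1 * w^-1 * y)%g) in
  let q : B := (((1, w^-1 * y) : B) * g^-1 ^+ n)%g in
  bsm_fiber_act a (sweedler_power n (bsm k M x b)) (basis_vec k y) =
  if (q.1 == b^-1)%g then basis_vec k (x * q.2)%g else 0.
Proof.
pose act := HB.pack_for {linear bismash k M -> bsm_fiber k G}
  (fun h => bsm_fiber_act a h (basis_vec k y))
  (GRing.isLinear.Build _ _ _ _ _ (bsm_fiber_act_linear_l a (basis_vec k y))).
elim: n x b => [|n IHn] x b w g.
  (* For n = 0, q = (1, w^-1 y): the test becomes b = 1, and then w = x, so the vector is y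
     itself. *)
  rewrite /= mulg1 mp_lact_1 mp_ract1 mulg1 [counit _]bsm_counitE.
  rewrite -[LHS]/(act _) linearZ /= bsm_fiber_act1 [_ == b^-1%g]eq_sym invg_eq1.
  case: eqP => [b1|_]; last by rewrite scale0r.
  by rewrite scale1r /w b1 mp_ract1 mulKVg.
(* Since (x ◁ c) ◁ (c^-1 b) = x ◁ b, every term of the coproduct has the same w and g, so one
   sequence [r] serves both n and n.+1. *)
pose r m : B := (((1, w^-1 * y) : B) * g^-1 ^+ m)%g.
rewrite -/(r n.+1) /=.
have r2 : (r n.+1).2 = ((w ◁ (r n).1) * (r n).2)%g.
  (* This amounts to (1, y) g = (y ▷ a, w^-1 y), the identity behind the choice of g. The left
     factor from F does not affect the second component. *)
  have -> : r n.+1 = ((((y ▷ a)^-1, 1) : B) * (((1, w) : B) * r n))%g.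
    rewrite /r expgS !mulgA; congr (_ * _)%g.
    apply: (mulIg g); rewrite mulgKV !bowtie_mulE /=.
    rewrite !mp_ract1 mp_lact_1 !mulg1 !mul1g mulKVg mp_lact_1 mulg1 mulVg.
    by rewrite !mulgA mulgV mul1g.
  by rewrite !bowtie_mulE /= mp_ract_1 !mul1g.
have r1 : (r n).1 = ((r n.+1).1 * ((r n.+1).2 ▷ a))%g.
  have -> : r n = (r n.+1 * g)%g by rewrite /r expgSr mulgA mulgKV.
  by [].
(* By induction the inner power survives only for c = b (r n).1. Then [r2] identifies its output as
   (r n.+1).2, and [r1] turns the test for the outer factor into b (r n.+1).1 = 1. *)
have E c : bsm_fiber_act a (bsm k M x c *
      sweedler_power n (bsm k M (x ◁ c) (c^-1 * b)%g)) (basis_vec k y) =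
    if (c == b * (r n).1)%g && ((r n.+1).1 == b^-1)%g
    then basis_vec k (x * (r n.+1).2)%g else 0.
  rewrite bsm_fiber_actM IHn -mp_ractM mulKVg -/w -/g -/(r n) invMg invgK.
  have -> : ((r n).1 == b^-1 * c)%g = (c == b * (r n).1)%g.
    by apply/eqP/eqP => ->; rewrite ?mulKVg ?mulKg.
  case: eqP => [->|_]; last by rewrite linear0.
  rewrite andTb mp_ractM -r2 bsm_fiber_actE; congr (if _ then _ else _).
  rewrite r1 mulgA -[X in _ == X]mul1g (inj_eq (mulIg _)).
  by rewrite -eq_invg_mul eq_sym.
rewrite bsm_lift_comul; first 1 last.
- by move=> v c u u'; rewrite mulrDl -scalerAl.
- by move=> u c v v'; rewrite sweedler_power_linear mulrDr -scalerAr.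
rewrite -[LHS]/(act _) linear_sum (eq_bigr _ (fun c _ => E c)).
by rewrite (bigD1 (b * (r n).1)%g) //= eqxx big1 ?addr0 // => c /negPf ->.
Qed.

(** Multiplying the sum by y#p_b on either side gives 0 unless b = 1, and otherwise only translates
    the index in G. *)
Lemma bsm_normalized_integral : #|G|%:R != 0 :> k ->
  normalized_integral (bismash k M) = #|G|%:R^-1 *: \sum_x bsm k M x 1%g.
Proof.
move=> nzG; pose L : bismash k M := \sum_x bsm k M x 1%g.
have intL : is_integral L.
  move=> h; split; move: h; apply: bsm_ext => [c u v|c u v|y b].
  - by rewrite mulrDl -scalerAl.
  - by rewrite linearP scalerDl scalerA.
  - rewrite [counit _]bsm_counitE mulr_sumr.
    under eq_bigr => x _ do rewrite bsm_mulE mp_lact_1.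
    case: eqP => _; last by rewrite scale0r big1.
    by rewrite scale1r /L [RHS](reindex_inj (mulgI y)).
  - by rewrite mulrDr -scalerAr.
  - by rewrite linearP scalerDl scalerA.
  - rewrite [counit _]bsm_counitE mulr_suml.
    have -> : (b == 1%g) = (1%g == y ▷ b).
      by apply/eqP/eqP => [->|/esym/mp_lactV ->]; rewrite mp_lact_1.
    under eq_bigr => x _ do rewrite bsm_mulE.
    case: eqP => [/esym/mp_lactV|_]; last by rewrite scale0r big1.
    by rewrite mp_lact_1 => ->; rewrite scale1r /L [RHS](reindex_inj (mulIg y)).
apply: normalized_integralE => [h|].
  have [hL Lh] := intL h.
  by rewrite -scalerAr -scalerAl hL Lh !scalerA mulrC.
rewrite linearZ linear_sum /=.
under eq_bigr => x _ do rewrite [counit _]bsm_counitE eqxx.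
by rewrite sumr_const; exact: mulVf.
Qed.

Lemma bsm_module_indicator (a : F) (n : nat) : #|G|%:R != 0 :> k ->
  FS_indicator n (bsm_module k M a) =
    #|[set z : G | (((a, z) : B) ^+ n == ((1, 1) : B))%g]|%:R.
Proof.
move=> nzG; rewrite /FS_indicator /mod_char mxtrace_free_space.
rewrite bsm_normalized_integral //.
pose P (z : G) := (((a, z) : B) ^+ n == ((1, 1) : B))%g.
pose z (y x : G) : G := ((y ◁ a)^-1 * x^-1 * y)%g.
have E y x : (bsm_fiber_act a (sweedler_power n (bsm k M x 1%g)) (basis_vec k y)
    : {ffun G -> k^o}) y = (P (z y x))%:R.
  rewrite bsm_sweedler_power_act; cbv zeta; rewrite mp_ract1 -/(z y x).
  set u : B := (1%g, (x^-1 * y)%g); set g : B := (a, z y x).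
  (* Here b = 1 and w = x, so y is fixed iff q = (1, x^-1 y) = u, that is, iff g^-n = 1. *)
  have -> : P (z y x) = (u * g^-1 ^+ n == u)%g.
    rewrite /P -/g -[X in _ = (_ == X)]mulg1 (inj_eq (mulgI u)) expVgn.
    by rewrite invg_eq1.
  case: (u * _)%g => c v; rewrite invg1 /u xpair_eqE /=.
  case: (c == 1%g); last by rewrite ffunE.
  by rewrite ffunE -[y in LHS](mulKVg x) (inj_eq (mulgI x)) eq_sym.
have zbij y : bijective (z y).
  exists (fun t => (y * t^-1 * (y ◁ a)^-1)%g) => x; rewrite /z.
    by rewrite !invMg !invgK !mulgA mulgV mul1g mulgK.
  by rewrite !invMg !invgK !mulgA mulVg mul1g mulgKV.
transitivity (\sum_(y : G) #|G|%:R^-1 * \sum_x (P (z y x))%:R : k).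
  apply: eq_bigr => y _; rewrite lfunE /=.
  (* The diagonal coefficient at y is a linear form in h, so the integral can be expanded term by
     term. *)
  pose f (h : bismash k M) : k^o := (bsm_fiber_act a
      (sweedler_power n h) (basis_vec k y) : {ffun G -> k^o}) y.
  have lin : linear f.
    by move=> c u v; rewrite /f sweedler_power_linear bsm_fiber_act_linear_l !ffunE.
  pose phi := HB.pack_for {linear bismash k M -> k^o} f
    (GRing.isLinear.Build _ _ _ _ _ lin).
  rewrite -[LHS]/(phi _) linearZ linear_sum; congr (_ * _).
  by apply: eq_bigr => x _; apply: E.
have card_z y : \sum_x (P (z y x))%:R = #|[set t | P t]|%:R :> k.
  rewrite -sum1dep_card natr_sum [RHS](reindex (z y)) /=; last exact: onW_bij.
  rewrite [RHS]big_mkcond; by apply: eq_bigr => x _; case: (P _).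
under eq_bigr => y _ do rewrite card_z.
by rewrite -mulr_suml sumr_const -[_^-1 *+ _]mulr_natl divff // mul1r.
Qed.
End BismashIndicator.

Theorem proposition1p3 (R : realType) (F G : finGroupType)
    (M : matched_pair F G) (a : F) (n : nat) (hn : (1 <= n)%N) :
  FS_indicator n (bsm_module (complex R) M a) =
    #|[set x : G | (((a, x) : bowtie M) ^+ n == ((1, 1) : bowtie M))%g]|%:R.
Proof.
apply: bsm_module_indicator.
(* The order of G is invertible: characteristic 0, and G contains 1. *)
by rewrite Num.Theory.pnatr_eq0 -lt0n; apply/card_gt0P; exists 1%g.
Qed.
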